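(* Let $M,\rho,l,k,T_0,Q,\alpha>0$ be fixed, put $\Omega_L=\sqrt{k/M}$, $\Omega_T=\frac{\pi}{2l}\sqrt{T_0/\rho}$, and for $\omega>0$ put $\omega_L=\omega/\Omega_L$, $\omega_T=\omega/\Omega_T$. For $\omega\neq\Omega_L$ sufficiently close to $\Omega_L$, let $$\varkappa=\frac{\pi^2Q}{4\alpha\omega l^2(1-\omega_L^2)},\quad \gamma=-\varkappa\Big(1-\sqrt{1-\tfrac1{\varkappa^2}}\Big),$$ $$A=\pm\frac{8l}{\pi\omega_L\sqrt{1+\gamma^2}}\sqrt{\frac{Q}{2kl}\sqrt{1-\frac1{\varkappa^2}}+\frac{T_0}{kl}\Big(1-\frac{\omega_T^2}{4}\Big)(1-\omega_L^2)},\quad B=\gamma A$$ (with a fixed choice of sign), and $$u(t)=-\frac{\pi^2}{32l}(A^2+B^2)+\frac{1}{1-\omega_L^2}\Big[\Big(\frac Qk-\frac{\pi^2}{32l}(A^2-B^2)\Big)\cos\omega t-\frac{\pi^2}{16l}AB\sin\omega t\Big],$$ $$T_1(t)=\frac1{1-\omega_L^2}\Big[\Big(Q-\frac{\pi^2k\omega_L^2}{32l}(A^2-B^2)\Big)\cos\omega t-\frac{\pi^2k\omega_L^2}{16l}AB\sin\omega t\Big].$$ Then as $\omega\to\Omega_L$ (resonant excitation, $\omega_L\to1$), $$A\to\pm\frac{4l}{\pi}\sqrt{\frac{2Q}{kl}},\qquad B\to0,$$ so that the limiting transverse amplitude is independent of both $\Omega_T$ and the viscosity $\alpha$; and, for each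 $t$, the functions $u(t)$ and $T_1(t)$ converge to $$u(t)=-\frac Qk-\Big[\frac{2T_0}{k}\Big(1-\frac{\omega_T^2}{4}\Big)+\frac Qk\Big]\cos\omega t+\frac{4\alpha\omega l^2}{\pi^2k}\sin\omega t,$$ $$T_1(t)=-2T_0\Big(1-\frac{\omega_T^2}{4}\Big)\cos\omega t+\frac{4\alpha\omega l^2}{\pi^2}\sin\omega t,$$ with $\omega=\Omega_L$ and $\omega_T=\Omega_L/\Omega_T$ on the right-hand sides.
   Context: $A$ and $B$ are the coefficients of the approximate steady transverse oscillation $w(t)=A\cos\frac{\omega t}{2}+B\sin\frac{\omega t}{2}$, $u$ is the longitudinal displacement and $T_1$ the variable part of the tensile force, for the mass-string model $M\ddot u+T_1=Q\cos\omega t$, $\rho\ddot w+\alpha\dot w+\frac{\pi^2}{4l^2}(T_0+T_1)w=0$, $T_1=k\big(u+\frac{\pi^2}{16l}w^2\big)$. All quantities needed in the claim are defined there explicitly. *)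

(* Defs.v *)
(* Stdlib real numbers with Coquelicot limits. *)
From Stdlib Require Import Reals.
From Coquelicot Require Import Coquelicot.
Open Scope R_scope.

Definition Omega_L (M k : R) : R := sqrt (k / M).
Definition Omega_T (rho l T0 : R) : R := PI / (2 * l) * sqrt (T0 / rho).

Definition omega_L (M k w : R) : R := w / Omega_L M k.
Definition omega_T (rho l T0 w : R) : R := w / Omega_T rho l T0.

Definition kappa (M l k Q alpha w : R) : R :=
  PI ^ 2 * Q / (4 * alpha * w * l ^ 2 * (1 - omega_L M k w ^ 2)).

Definition gamma (M l k Q alpha w : R) : R :=
  let kap := kappa M l k Q alpha w in
  - kap * (1 - sqrt (1 - 1 / kap ^ 2)).

(* The quantity under the outer square root in the coefficient A. *)
Definition radicand (M rho l k T0 Q alpha w : R) : R :=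
  Q / (2 * k * l) * sqrt (1 - 1 / kappa M l k Q alpha w ^ 2)
  + T0 / (k * l) * (1 - omega_T rho l T0 w ^ 2 / 4) * (1 - omega_L M k w ^ 2).

(* [sgn] stands for the sign in front of A; it is meant to be 1 or -1. *)
Definition coefA (sgn M rho l k T0 Q alpha w : R) : R :=
  sgn * (8 * l / (PI * omega_L M k w * sqrt (1 + gamma M l k Q alpha w ^ 2)))
  * sqrt (radicand M rho l k T0 Q alpha w).

Definition coefB (sgn M rho l k T0 Q alpha w : R) : R :=
  gamma M l k Q alpha w * coefA sgn M rho l k T0 Q alpha w.

(* Amplitude of A cos (w t / 2) + B sin (w t / 2). *)
Definition transverse_amplitude (sgn M rho l k T0 Q alpha w : R) : R :=
  sqrt (coefA sgn M rho l k T0 Q alpha w ^ 2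
        + coefB sgn M rho l k T0 Q alpha w ^ 2).

Definition displacement (sgn M rho l k T0 Q alpha w t : R) : R :=
  let A := coefA sgn M rho l k T0 Q alpha w in
  let B := coefB sgn M rho l k T0 Q alpha w in
  - (PI ^ 2 / (32 * l)) * (A ^ 2 + B ^ 2)
  + 1 / (1 - omega_L M k w ^ 2)
    * ((Q / k - PI ^ 2 / (32 * l) * (A ^ 2 - B ^ 2)) * cos (w * t)
       - PI ^ 2 / (16 * l) * A * B * sin (w * t)).

Definition tension (sgn M rho l k T0 Q alpha w t : R) : R :=
  let A := coefA sgn M rho l k T0 Q alpha w in
  let B := coefB sgn M rho l k T0 Q alpha w in
  1 / (1 - omega_L M k w ^ 2)
  * ((Q - PI ^ 2 * k * omega_L M k w ^ 2 / (32 * l) * (A ^ 2 - B ^ 2))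
       * cos (w * t)
     - PI ^ 2 * k * omega_L M k w ^ 2 / (16 * l) * A * B * sin (w * t)).

(* Main.v *)
(** Near resonance everything is governed by [x = 1 / kappa], which is a smooth
    function of [w] vanishing at [W].  With [s = sqrt (1 - x ^ 2)] one has
    [gamma = - x / (1 + s)], hence [1 + gamma ^ 2 = 2 / (1 + s)] and
    [1 - gamma ^ 2 = 2 * s / (1 + s)].  So [A ^ 2 + B ^ 2], [A ^ 2 - B ^ 2] and
    [A * B] are proportional to [r], [s * r] and [x * r], where [r] is the
    radicand.  In [u] and [T1] the small denominator [1 - omega_L ^ 2] then
    cancels, because it divides both [x] and [1 - s ^ 2 = x ^ 2], and the
    limits are obtained by evaluating continuous functions at [W]. *)
Require Import Defs.
From Stdlib Require Import Reals Lra.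
From Coquelicot Require Import Coquelicot.
Open Scope R_scope.

(** * Substitutes for 1 / kappa, gamma and the radicand that stay regular at resonance *)

Definition inv_kappa (M l k Q alpha w : R) : R :=
  4 * alpha * l ^ 2 / (PI ^ 2 * Q) * w * (1 - omega_L M k w ^ 2).

Definition kappa_root (M l k Q alpha w : R) : R :=
  sqrt (1 - inv_kappa M l k Q alpha w ^ 2).

(** Conjugating 1 - s replaces the product of an unbounded [kappa] and a vanishing factor by a
    quotient whose denominator tends to 2. *)
Definition regular_gamma (M l k Q alpha w : R) : R :=
  - inv_kappa M l k Q alpha w / (1 + kappa_root M l k Q alpha w).

Definition regular_radicand (M rho l k T0 Q alpha w : R) : R :=
  Q / (2 * k * l) * kappa_root M l k Q alpha w
  + T0 / (k * l) * (1 - omega_T rho l T0 w ^ 2 / 4) * (1 - omega_L M k w ^ 2).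

(** * Positivity, detuning and values at resonance *)

Lemma Omega_L_gt0 (M k : R) : 0 < M -> 0 < k -> 0 < Omega_L M k.
Proof. intros HM Hk. apply sqrt_lt_R0, Rdiv_lt_0_compat; assumption. Qed.

Lemma omega_L_Omega_L (M k : R) :
  0 < M -> 0 < k -> omega_L M k (Omega_L M k) = 1.
Proof.
intros HM Hk. unfold omega_L. field.
apply Rgt_not_eq, Omega_L_gt0; assumption.
Qed.

Lemma omega_L_gt0 (M k w : R) : 0 < M -> 0 < k -> 0 < w -> 0 < omega_L M k w.
Proof. intros HM Hk Hw. apply Rdiv_lt_0_compat, Omega_L_gt0; assumption. Qed.

Lemma detuning_neq0 (M k w : R) :
  0 < M -> 0 < k -> 0 < w -> w <> Omega_L M k -> 1 - omega_L M k w ^ 2 <> 0.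
Proof.
intros HM Hk Hw Hne H.
pose proof (omega_L_gt0 M k w HM Hk Hw) as Ho.
pose proof (Omega_L_gt0 M k HM Hk) as HW.
(* Positivity excludes the root -1 of [omega_L ^ 2 = 1]. *)
assert (E : omega_L M k w = 1) by nra.
apply Hne. replace w with (omega_L M k w * Omega_L M k).
- rewrite E; ring.
- unfold omega_L; field; lra.
Qed.

Lemma inv_kappa_Omega_L (M l k Q alpha : R) :
  0 < M -> 0 < k -> inv_kappa M l k Q alpha (Omega_L M k) = 0.
Proof. intros HM Hk. unfold inv_kappa. rewrite omega_L_Omega_L by assumption. ring. Qed.

Lemma kappa_root_Omega_L (M l k Q alpha : R) :
  0 < M -> 0 < k -> kappa_root M l k Q alpha (Omega_L M k) = 1.
Proof.
intros HM Hk. unfold kappa_root. rewrite inv_kappa_Omega_L by assumption.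
replace (1 - 0 ^ 2) with 1 by ring. apply sqrt_1.
Qed.

Lemma regular_gamma_Omega_L (M l k Q alpha : R) :
  0 < M -> 0 < k -> regular_gamma M l k Q alpha (Omega_L M k) = 0.
Proof.
intros HM Hk. unfold regular_gamma.
rewrite inv_kappa_Omega_L, kappa_root_Omega_L by assumption. field.
Qed.

Lemma regular_radicand_Omega_L (M rho l k T0 Q alpha : R) :
  0 < M -> 0 < k ->
  regular_radicand M rho l k T0 Q alpha (Omega_L M k) = Q / (2 * k * l).
Proof.
intros HM Hk. unfold regular_radicand.
rewrite kappa_root_Omega_L, omega_L_Omega_L by assumption. ring.
Qed.

(** * Differentiability, as a source of continuity at resonance *)

Lemma ex_derive_omega_L (M k w : R) : ex_derive (omega_L M k) w.
Proof. unfold omega_L, Rdiv. auto_derive; exact I. Qed.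

Lemma ex_derive_omega_T (rho l T0 w : R) : ex_derive (omega_T rho l T0) w.
Proof. unfold omega_T, Rdiv. auto_derive; exact I. Qed.

Lemma ex_derive_inv_kappa (M l k Q alpha w : R) :
  ex_derive (inv_kappa M l k Q alpha) w.
Proof.
unfold inv_kappa. auto_derive. repeat split; simple apply ex_derive_omega_L.
Qed.

(** The argument of the root equals 1 at resonance, hence lies where [sqrt] is differentiable. *)
Lemma ex_derive_kappa_root (M l k Q alpha : R) :
  0 < M -> 0 < k -> ex_derive (kappa_root M l k Q alpha) (Omega_L M k).
Proof.
intros HM Hk. unfold kappa_root. auto_derive.
repeat split; try simple apply ex_derive_inv_kappa.
rewrite inv_kappa_Omega_L by assumption. lra.
Qed.

Lemma ex_derive_regular_gamma (M l k Q alpha : R) :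
  0 < M -> 0 < k -> ex_derive (regular_gamma M l k Q alpha) (Omega_L M k).
Proof.
intros HM Hk. unfold regular_gamma. auto_derive.
repeat split; try simple apply ex_derive_inv_kappa;
  try (simple apply ex_derive_kappa_root; assumption).
rewrite kappa_root_Omega_L by assumption. lra.
Qed.

Lemma ex_derive_regular_radicand (M rho l k T0 Q alpha : R) :
  0 < M -> 0 < k ->
  ex_derive (regular_radicand M rho l k T0 Q alpha) (Omega_L M k).
Proof.
intros HM Hk. unfold regular_radicand. auto_derive.
repeat split; try simple apply ex_derive_omega_L; try simple apply ex_derive_omega_T;
  simple apply ex_derive_kappa_root; assumption.
Qed.

(** * Open conditions and limits by local replacement *)

Lemma locally_gt (f : R -> R) (a b : R) :
  ex_derive f a -> b < f a -> locally a (fun w => b < f w).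
Proof.
intros Hf Hb. apply (ex_derive_continuous f a Hf).
apply (open_gt b (f a) Hb).
Qed.

(** The pattern for the limits of A, gamma, u and T1: evaluate a regular substitute at the centre.
    Agreement is asked only on a punctured neighbourhood, since at resonance the original formulas
    divide by zero. *)
Lemma is_lim_eq_loc (f g : R -> R) (a L : R) :
  locally' a (fun w => g w = f w) -> ex_derive f a -> f a = L -> is_lim g a L.
Proof.
intros Heq Hf HL. apply is_lim_ext_loc with f.
- apply filter_imp with (2 := Heq). intros w H; symmetry; exact H.
- rewrite <- HL. apply is_lim_continuity.
  apply continuity_pt_filterlim. apply (ex_derive_continuous f a Hf).
Qed.

(** * Agreement of the original and regular quantities near resonance *)

Lemma kappa_regular (M l k Q alpha w : R) :
  0 < l -> 0 < Q -> 0 < alpha -> 0 < w -> 1 - omega_L M k w ^ 2 <> 0 ->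
  kappa M l k Q alpha w <> 0 /\ kappa M l k Q alpha w = / inv_kappa M l k Q alpha w.
Proof.
intros Hl HQ Ha Hw He. pose proof PI_RGT_0 as Hpi.
assert (E : kappa M l k Q alpha w = / inv_kappa M l k Q alpha w).
{ unfold kappa, inv_kappa. field. repeat split; try lra. }
split; [|exact E]. rewrite E. apply Rinv_neq_0_compat. unfold inv_kappa.
repeat apply Rmult_integral_contrapositive_currified; try lra.
apply Rinv_neq_0_compat, Rmult_integral_contrapositive_currified; try lra.
apply pow_nonzero; lra.
Qed.

(** Positivity is stated for the regular forms, so that it can be obtained from their continuity at
    resonance. *)
Definition near_resonance (M rho l k T0 Q alpha w : R) : Prop :=
  0 < w /\ 1 - omega_L M k w ^ 2 <> 0
  /\ 0 < 1 - inv_kappa M l k Q alpha w ^ 2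
  /\ 0 < regular_radicand M rho l k T0 Q alpha w.

(** The three strict inequalities hold at resonance, with left-over values [Omega_L], 1 and Q / (2 k
    l), and persist on a full neighbourhood. Only the nonzero detuning requires removing the
    centre. *)
Lemma locally_near_resonance (M rho l k T0 Q alpha : R) :
  0 < M -> 0 < l -> 0 < k -> 0 < Q ->
  locally' (Omega_L M k) (near_resonance M rho l k T0 Q alpha).
Proof.
intros HM Hl Hk HQ. pose proof (Omega_L_gt0 M k HM Hk) as HW.
assert (H1 : locally (Omega_L M k) (fun w => 0 < w)).
{ apply (locally_gt (fun w => w)); [apply ex_derive_id | exact HW]. }
assert (H2 : locally (Omega_L M k) (fun w => 0 < 1 - inv_kappa M l k Q alpha w ^ 2)).
{ apply (locally_gt (fun w => 1 - inv_kappa M l k Q alpha w ^ 2)).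
  - auto_derive. simple apply ex_derive_inv_kappa.
  - rewrite inv_kappa_Omega_L by assumption. lra. }
assert (H3 : locally (Omega_L M k)
               (fun w => 0 < regular_radicand M rho l k T0 Q alpha w)).
{ apply locally_gt.
  - simple apply ex_derive_regular_radicand; assumption.
  - rewrite regular_radicand_Omega_L by assumption.
    apply Rdiv_lt_0_compat; [exact HQ | nra]. }
generalize (filter_and _ _ H1 (filter_and _ _ H2 H3)).
unfold locally', within. apply filter_imp.
intros w [Hw [Hx Hr]] Hne. unfold near_resonance.
repeat split; try assumption. apply detuning_neq0; assumption.
Qed.

Lemma inv_kappa_neq0 (M l k Q alpha w : R) :
  0 < l -> 0 < Q -> 0 < alpha -> 0 < w -> 1 - omega_L M k w ^ 2 <> 0 ->
  inv_kappa M l k Q alpha w <> 0.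
Proof.
intros Hl HQ Ha Hw He.
destruct (kappa_regular M l k Q alpha w) as [Hk E]; try assumption.
(* By the convention [/ 0 = 0], a vanishing [inv_kappa] would make [kappa] vanish. *)
intro H. apply Hk. rewrite E, H. apply Rinv_0.
Qed.

Lemma inv_kappa_sqr (M l k Q alpha w : R) :
  0 < l -> 0 < Q -> 0 < alpha -> 0 < w -> 1 - omega_L M k w ^ 2 <> 0 ->
  1 / kappa M l k Q alpha w ^ 2 = inv_kappa M l k Q alpha w ^ 2.
Proof.
intros Hl HQ Ha Hw He.
destruct (kappa_regular M l k Q alpha w) as [_ E]; try assumption.
rewrite E. field. apply inv_kappa_neq0; assumption.
Qed.

Lemma kappa_root_sqr (M l k Q alpha w : R) :
  0 < 1 - inv_kappa M l k Q alpha w ^ 2 ->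
  0 < kappa_root M l k Q alpha w
  /\ kappa_root M l k Q alpha w ^ 2 = 1 - inv_kappa M l k Q alpha w ^ 2.
Proof.
intros H. split.
- apply sqrt_lt_R0, H.
- unfold kappa_root. apply pow2_sqrt. lra.
Qed.

Lemma radicand_regular (M rho l k T0 Q alpha w : R) :
  0 < l -> 0 < Q -> 0 < alpha -> 0 < w -> 1 - omega_L M k w ^ 2 <> 0 ->
  radicand M rho l k T0 Q alpha w = regular_radicand M rho l k T0 Q alpha w.
Proof.
intros. unfold radicand, regular_radicand, kappa_root.
rewrite inv_kappa_sqr by assumption. reflexivity.
Qed.

Lemma gamma_regular (M rho l k T0 Q alpha w : R) :
  0 < l -> 0 < Q -> 0 < alpha -> near_resonance M rho l k T0 Q alpha w ->
  gamma M l k Q alpha w = regular_gamma M l k Q alpha w.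
Proof.
intros Hl HQ Ha [Hw [He [Hx _]]]. unfold gamma, regular_gamma. cbv zeta.
rewrite inv_kappa_sqr by assumption. fold (kappa_root M l k Q alpha w).
destruct (kappa_regular M l k Q alpha w) as [_ E]; try assumption. rewrite E.
pose proof (inv_kappa_neq0 M l k Q alpha w Hl HQ Ha Hw He) as Hx0.
destruct (kappa_root_sqr M l k Q alpha w Hx) as [Hs Hs2].
set (x := inv_kappa M l k Q alpha w) in *.
set (s := kappa_root M l k Q alpha w) in *.
(* This factor clears both denominators and leaves - (1 - s ^ 2) = - x ^ 2. *)
apply Rmult_eq_reg_r with (x * (1 + s)).
- transitivity (- (1 - s ^ 2)); [field; lra | rewrite Hs2; field; lra].
- apply Rmult_integral_contrapositive_currified; lra.
Qed.

Lemma coefA_regular (sgn M rho l k T0 Q alpha w : R) :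
  0 < l -> 0 < Q -> 0 < alpha -> near_resonance M rho l k T0 Q alpha w ->
  coefA sgn M rho l k T0 Q alpha w =
  sgn * (8 * l / (PI * omega_L M k w
                  * sqrt (1 + regular_gamma M l k Q alpha w ^ 2)))
  * sqrt (regular_radicand M rho l k T0 Q alpha w).
Proof.
intros Hl HQ Ha H. unfold coefA.
rewrite (gamma_regular M rho l k T0) by assumption.
destruct H as [Hw [He _]].
rewrite radicand_regular by assumption. reflexivity.
Qed.

(** * Quadratic expressions in A and B *)

Lemma coefA_sqr (sgn M rho l k T0 Q alpha w : R) :
  0 < M -> 0 < l -> 0 < k -> 0 < Q -> 0 < alpha -> sgn = 1 \/ sgn = -1 ->
  near_resonance M rho l k T0 Q alpha w ->
  coefA sgn M rho l k T0 Q alpha w ^ 2 =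
  32 * l ^ 2 * (1 + kappa_root M l k Q alpha w)
  * regular_radicand M rho l k T0 Q alpha w / (PI ^ 2 * omega_L M k w ^ 2).
Proof.
intros HM Hl Hk HQ Ha Hsgn H. pose proof PI_RGT_0 as Hpi.
rewrite coefA_regular by assumption.
destruct H as [Hw [He [Hx Hr]]].
pose proof (omega_L_gt0 M k w HM Hk Hw) as Ho.
destruct (kappa_root_sqr M l k Q alpha w Hx) as [Hs Hs2].
(* From x ^ 2 + s ^ 2 = 1 follows (1 + s) ^ 2 + x ^ 2 = 2 (1 + s). *)
assert (Hg : 1 + regular_gamma M l k Q alpha w ^ 2
             = 2 / (1 + kappa_root M l k Q alpha w)).
{ unfold regular_gamma.
  set (x := inv_kappa M l k Q alpha w) in *.
  set (s := kappa_root M l k Q alpha w) in *.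
  replace ((- x / (1 + s)) ^ 2) with (x ^ 2 / (1 + s) ^ 2) by (field; lra).
  replace (x ^ 2) with (1 - s ^ 2) by lra. field. lra. }
rewrite Hg.
set (s := kappa_root M l k Q alpha w) in *.
set (r := regular_radicand M rho l k T0 Q alpha w) in *.
set (o := omega_L M k w) in *.
assert (Hq : 0 < 2 / (1 + s)) by (apply Rdiv_lt_0_compat; lra).
pose proof (sqrt_lt_R0 _ Hq) as Hq'.
assert (Hsgn2 : sgn ^ 2 = 1) by (destruct Hsgn as [-> | ->]; ring).
transitivity (sgn ^ 2 * (64 * l ^ 2 / (PI ^ 2 * o ^ 2 * sqrt (2 / (1 + s)) ^ 2))
              * sqrt r ^ 2); [field; lra|].
rewrite Hsgn2, !pow2_sqrt by lra. field. lra.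
Qed.

(** The coefficients enter u and T1 only through these three combinations, in which the sign of A
    and the outer square roots disappear. *)
Lemma coef_quadratics (sgn M rho l k T0 Q alpha w : R) :
  0 < M -> 0 < l -> 0 < k -> 0 < Q -> 0 < alpha -> sgn = 1 \/ sgn = -1 ->
  near_resonance M rho l k T0 Q alpha w ->
  let A := coefA sgn M rho l k T0 Q alpha w in
  let B := coefB sgn M rho l k T0 Q alpha w in
  let c := 32 * l ^ 2 * regular_radicand M rho l k T0 Q alpha w
           / (PI ^ 2 * omega_L M k w ^ 2) in
  A ^ 2 + B ^ 2 = 2 * c
  /\ A ^ 2 - B ^ 2 = 2 * c * kappa_root M l k Q alpha w
  /\ A * B = - c * inv_kappa M l k Q alpha w.
Proof.
intros HM Hl Hk HQ Ha Hsgn H A B c.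
assert (HB : B = regular_gamma M l k Q alpha w * A).
{ unfold B, coefB. rewrite (gamma_regular M rho l k T0) by assumption.
  reflexivity. }
assert (HA : A ^ 2 = c * (1 + kappa_root M l k Q alpha w)).
{ unfold A, c. rewrite coefA_sqr by assumption. unfold Rdiv. ring. }
clearbody A B c. subst B.
destruct H as [_ [_ [Hx _]]].
destruct (kappa_root_sqr M l k Q alpha w Hx) as [Hs Hs2].
unfold regular_gamma.
set (x := inv_kappa M l k Q alpha w) in *.
set (s := kappa_root M l k Q alpha w) in *.
(* With x ^ 2 = (1 - s) (1 + s), one factor 1 + s of the denominator cancels against x ^ 2 and the
   other against A ^ 2. *)
assert (HB2 : (- x / (1 + s) * A) ^ 2 = c * (1 - s)).
{ transitivity (x ^ 2 * A ^ 2 / (1 + s) ^ 2); [field; lra|].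
  rewrite HA. replace (x ^ 2) with (1 - s ^ 2) by lra. field. lra. }
rewrite HB2, HA. repeat split; try ring.
transitivity (- x * A ^ 2 / (1 + s)); [field; lra|].
rewrite HA. field. lra.
Qed.

(** * Cancellation of the small denominator in T1 and u *)

Lemma tension_regular (sgn M rho l k T0 Q alpha w t : R) :
  0 < M -> 0 < l -> 0 < k -> 0 < Q -> 0 < alpha -> sgn = 1 \/ sgn = -1 ->
  near_resonance M rho l k T0 Q alpha w ->
  tension sgn M rho l k T0 Q alpha w t =
  (4 * alpha * l ^ 2 / PI ^ 2 * w * inv_kappa M l k Q alpha w
   - 2 * T0 * (1 - omega_T rho l T0 w ^ 2 / 4) * kappa_root M l k Q alpha w)
  * cos (w * t)
  + 8 * alpha * k * l ^ 3 / (PI ^ 2 * Q) * w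
    * regular_radicand M rho l k T0 Q alpha w * sin (w * t).
Proof.
intros HM Hl Hk HQ Ha Hsgn H. pose proof PI_RGT_0 as Hpi.
unfold tension. cbv zeta.
destruct (coef_quadratics sgn M rho l k T0 Q alpha w) as [_ [HD HP]];
  try assumption.
rewrite HD. rewrite (Rmult_assoc _ (coefA _ _ _ _ _ _ _ _ _)), HP.
destruct H as [Hw [He [Hx _]]].
pose proof (omega_L_gt0 M k w HM Hk Hw) as Ho.
destruct (kappa_root_sqr M l k Q alpha w Hx) as [_ Hs2].
(* The factors PI ^ 2 and [omega_L ^ 2] cancel, leaving the detuning as the only denominator that
   vanishes at resonance. *)
transitivity (((Q - 2 * k * l * kappa_root M l k Q alpha w
                      * regular_radicand M rho l k T0 Q alpha w) * cos (w * t)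
               + 2 * k * l * inv_kappa M l k Q alpha w
                 * regular_radicand M rho l k T0 Q alpha w * sin (w * t))
              / (1 - omega_L M k w ^ 2)); [field; lra|].
apply Rmult_eq_reg_r with (1 - omega_L M k w ^ 2); [|exact He].
unfold Rdiv at 1. rewrite Rmult_assoc, Rinv_l, Rmult_1_r by exact He.
(* Expanding the radicand gives Q (1 - s ^ 2) plus a multiple of the detuning. As 1 - s ^ 2 = x ^ 2
   and x contains the detuning, every term is now divisible by it. *)
replace (Q - 2 * k * l * kappa_root M l k Q alpha w
             * regular_radicand M rho l k T0 Q alpha w)
  with (Q * inv_kappa M l k Q alpha w ^ 2
        - 2 * T0 * (1 - omega_T rho l T0 w ^ 2 / 4)
          * (1 - omega_L M k w ^ 2) * kappa_root M l k Q alpha w).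
- unfold inv_kappa. field. lra.
- replace (inv_kappa M l k Q alpha w ^ 2)
    with (1 - kappa_root M l k Q alpha w ^ 2) by lra.
  unfold regular_radicand. field. lra.
Qed.

(* The two cosine amplitudes are related through
   [Q / k = (Q - Q * (1 - omega_L ^ 2)) / (k * omega_L ^ 2)]. *)
Lemma displacement_tension (sgn M rho l k T0 Q alpha w t : R) :
  0 < M -> 0 < l -> 0 < k -> 0 < Q -> 0 < alpha -> sgn = 1 \/ sgn = -1 ->
  near_resonance M rho l k T0 Q alpha w ->
  displacement sgn M rho l k T0 Q alpha w t =
  - (2 * l * regular_radicand M rho l k T0 Q alpha w / omega_L M k w ^ 2)
  + (tension sgn M rho l k T0 Q alpha w t - Q * cos (w * t))
    / (k * omega_L M k w ^ 2).
Proof.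
intros HM Hl Hk HQ Ha Hsgn H. pose proof PI_RGT_0 as Hpi.
unfold displacement, tension. cbv zeta.
destruct (coef_quadratics sgn M rho l k T0 Q alpha w) as [HS _];
  try assumption.
rewrite HS. destruct H as [Hw [He _]].
pose proof (omega_L_gt0 M k w HM Hk Hw) as Ho.
field. lra.
Qed.

(** * Limits at resonance *)

Lemma is_lim_coefA (sgn M rho l k T0 Q alpha : R) :
  0 < M -> 0 < l -> 0 < k -> 0 < Q -> 0 < alpha ->
  is_lim (fun w => coefA sgn M rho l k T0 Q alpha w) (Omega_L M k)
    (sgn * (4 * l / PI * sqrt (2 * Q / (k * l)))).
Proof.
intros HM Hl Hk HQ Ha. pose proof PI_RGT_0 as Hpi.
(* The regular substitute is left open here and gets fixed by unification with [coefA_regular]. *)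
eapply is_lim_eq_loc.
- eapply filter_imp; [|exact (locally_near_resonance M rho l k T0 Q alpha HM Hl Hk HQ)].
  intros w H. apply coefA_regular; assumption.
- auto_derive. rewrite omega_L_Omega_L, regular_gamma_Omega_L,
    regular_radicand_Omega_L by assumption.
  replace (1 + 0 * (0 * 1)) with 1 by ring. rewrite ?sqrt_1.
  repeat split; try simple apply ex_derive_omega_L; try lra;
    try (simple apply ex_derive_regular_gamma; assumption);
    try (simple apply ex_derive_regular_radicand; assumption).
  apply Rdiv_lt_0_compat; nra.
- cbv beta. rewrite omega_L_Omega_L, regular_gamma_Omega_L,
    regular_radicand_Omega_L by assumption.
  replace (1 + 0 ^ 2) with 1 by ring. rewrite sqrt_1.
  (* Pulling 2 out of the root reconciles the 4 of the limit with the 8 in A. *)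
  replace (2 * Q / (k * l)) with (2 ^ 2 * (Q / (2 * k * l))) by (field; lra).
  rewrite sqrt_mult_alt, sqrt_pow2 by lra. field. lra.
Qed.

Lemma is_lim_coefB (sgn M rho l k T0 Q alpha : R) :
  0 < M -> 0 < l -> 0 < k -> 0 < Q -> 0 < alpha ->
  is_lim (fun w => coefB sgn M rho l k T0 Q alpha w) (Omega_L M k) 0.
Proof.
intros HM Hl Hk HQ Ha. unfold coefB.
(* The target 0 is written as the limit 0 of gamma times the limit of A. *)
rewrite <- (Rmult_0_l (sgn * (4 * l / PI * sqrt (2 * Q / (k * l))))).
apply (is_lim_mult _ _ _ (Finite _) (Finite _)); [| |exact I].
- apply is_lim_eq_loc with (regular_gamma M l k Q alpha).
  + eapply filter_imp; [|exact (locally_near_resonance M rho l k T0 Q alpha HM Hl Hk HQ)].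
    intros w H. apply (gamma_regular M rho l k T0); assumption.
  + simple apply ex_derive_regular_gamma; assumption.
  + apply regular_gamma_Omega_L; assumption.
- apply is_lim_coefA; assumption.
Qed.

(** The limit is kept unsimplified: what matters is that its expression is free of [rho], [T0] and
    [alpha]. *)
Lemma is_lim_transverse_amplitude (sgn M rho l k T0 Q alpha : R) :
  0 < M -> 0 < l -> 0 < k -> 0 < Q -> 0 < alpha ->
  is_lim (fun w => transverse_amplitude sgn M rho l k T0 Q alpha w)
    (Omega_L M k) (sqrt ((sgn * (4 * l / PI * sqrt (2 * Q / (k * l)))) ^ 2)).
Proof.
intros HM Hl Hk HQ Ha.
pose proof (is_lim_coefA sgn M rho l k T0 Q alpha HM Hl Hk HQ Ha) as HA.
pose proof (is_lim_coefB sgn M rho l k T0 Q alpha HM Hl Hk HQ Ha) as HB.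
unfold transverse_amplitude.
apply (filterlim_comp _ _ _
  (fun w => coefA sgn M rho l k T0 Q alpha w ^ 2
            + coefB sgn M rho l k T0 Q alpha w ^ 2) sqrt _
  (locally ((sgn * (4 * l / PI * sqrt (2 * Q / (k * l)))) ^ 2))).
2: apply continuous_sqrt.
set (a := sgn * (4 * l / PI * sqrt (2 * Q / (k * l)))) in *.
change (is_lim (fun w => coefA sgn M rho l k T0 Q alpha w ^ 2
                 + coefB sgn M rho l k T0 Q alpha w ^ 2) (Omega_L M k) (a ^ 2)).
replace (a ^ 2) with (a * a + 0 * 0) by ring.
apply is_lim_ext with
  (fun w => coefA sgn M rho l k T0 Q alpha w * coefA sgn M rho l k T0 Q alpha w
            + coefB sgn M rho l k T0 Q alpha w * coefB sgn M rho l k T0 Q alpha w).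
{ intros w; ring. }
apply (is_lim_plus _ _ _ (Finite (a * a)) (Finite (0 * 0))); [| |reflexivity].
- exact (is_lim_mult _ _ _ (Finite a) (Finite a) HA HA I).
- exact (is_lim_mult _ _ _ (Finite 0) (Finite 0) HB HB I).
Qed.

Lemma is_lim_tension (sgn M rho l k T0 Q alpha t : R) :
  0 < M -> 0 < l -> 0 < k -> 0 < Q -> 0 < alpha -> sgn = 1 \/ sgn = -1 ->
  is_lim (fun w => tension sgn M rho l k T0 Q alpha w t) (Omega_L M k)
    (- 2 * T0 * (1 - omega_T rho l T0 (Omega_L M k) ^ 2 / 4)
       * cos (Omega_L M k * t)
     + 4 * alpha * Omega_L M k * l ^ 2 / PI ^ 2 * sin (Omega_L M k * t)).
Proof.
intros HM Hl Hk HQ Ha Hsgn. pose proof PI_RGT_0 as Hpi.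
eapply is_lim_eq_loc.
- eapply filter_imp; [|exact (locally_near_resonance M rho l k T0 Q alpha HM Hl Hk HQ)].
  intros w H. apply tension_regular; assumption.
- auto_derive.
  repeat split; try simple apply ex_derive_omega_T; try simple apply ex_derive_inv_kappa;
    try (simple apply ex_derive_kappa_root; assumption);
    try (simple apply ex_derive_regular_radicand; assumption).
- cbv beta. rewrite inv_kappa_Omega_L, kappa_root_Omega_L,
    regular_radicand_Omega_L by assumption.
  field. lra.
Qed.

Lemma is_lim_displacement (sgn M rho l k T0 Q alpha t : R) :
  0 < M -> 0 < l -> 0 < k -> 0 < Q -> 0 < alpha -> sgn = 1 \/ sgn = -1 ->
  is_lim (fun w => displacement sgn M rho l k T0 Q alpha w t) (Omega_L M k)
    (- (Q / k)
     - (2 * T0 / k * (1 - omega_T rho l T0 (Omega_L M k) ^ 2 / 4) + Q / k)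
       * cos (Omega_L M k * t)
     + 4 * alpha * Omega_L M k * l ^ 2 / (PI ^ 2 * k) * sin (Omega_L M k * t)).
Proof.
intros HM Hl Hk HQ Ha Hsgn. pose proof PI_RGT_0 as Hpi.
eapply is_lim_eq_loc.
- eapply filter_imp; [|exact (locally_near_resonance M rho l k T0 Q alpha HM Hl Hk HQ)].
  (* The regular form of u is inherited from that of T1. *)
  intros w H. rewrite displacement_tension, tension_regular by assumption.
  reflexivity.
- auto_derive. rewrite omega_L_Omega_L by assumption.
  repeat split; try simple apply ex_derive_omega_T; try simple apply ex_derive_omega_L;
    try simple apply ex_derive_inv_kappa; try lra;
    try (simple apply ex_derive_kappa_root; assumption);
    try (simple apply ex_derive_regular_radicand; assumption).
- cbv beta. rewrite inv_kappa_Omega_L, kappa_root_Omega_L,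
    regular_radicand_Omega_L, omega_L_Omega_L by assumption.
  field. lra.
Qed.

Theorem mainTheorem3 :
  forall M rho l k T0 Q alpha sgn : R,
    0 < M -> 0 < rho -> 0 < l -> 0 < k -> 0 < T0 -> 0 < Q -> 0 < alpha ->
    sgn = 1 \/ sgn = -1 ->
    let W := Omega_L M k in
    let WT := omega_T rho l T0 W in
    (* all quantities are well defined for w <> W sufficiently close to W *)
    locally' W (fun w =>
      0 < w /\ 1 - omega_L M k w ^ 2 <> 0 /\ kappa M l k Q alpha w <> 0 /\
      0 <= 1 - 1 / kappa M l k Q alpha w ^ 2 /\
      0 <= radicand M rho l k T0 Q alpha w) /\
    is_lim (fun w => coefA sgn M rho l k T0 Q alpha w) W
      (sgn * (4 * l / PI * sqrt (2 * Q / (k * l)))) /\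
    is_lim (fun w => coefB sgn M rho l k T0 Q alpha w) W 0 /\
    (* the limiting amplitude does not depend on rho, T0 (hence Omega_T), alpha *)
    (exists amp : R, forall rho' T0' alpha' : R,
       0 < rho' -> 0 < T0' -> 0 < alpha' ->
       is_lim (fun w => transverse_amplitude sgn M rho' l k T0' Q alpha' w)
         W amp) /\
    (forall t : R,
       is_lim (fun w => displacement sgn M rho l k T0 Q alpha w t) W
         (- (Q / k)
          - (2 * T0 / k * (1 - WT ^ 2 / 4) + Q / k) * cos (W * t)
          + 4 * alpha * W * l ^ 2 / (PI ^ 2 * k) * sin (W * t))) /\
    (forall t : R,
       is_lim (fun w => tension sgn M rho l k T0 Q alpha w t) W
         (- 2 * T0 * (1 - WT ^ 2 / 4) * cos (W * t)
          + 4 * alpha * W * l ^ 2 / PI ^ 2 * sin (W * t))).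
Proof.
intros M rho l k T0 Q alpha sgn HM Hrho Hl Hk HT0 HQ Ha Hsgn W WT.
split; [|split; [|split; [|split; [|split]]]].
- eapply filter_imp; [|exact (locally_near_resonance M rho l k T0 Q alpha HM Hl Hk HQ)].
  intros w [Hw [He [Hx Hr]]].
  rewrite inv_kappa_sqr, radicand_regular by assumption.
  destruct (kappa_regular M l k Q alpha w) as [Hkap _]; try assumption.
  repeat split; try assumption; lra.
- apply is_lim_coefA; assumption.
- apply is_lim_coefB; assumption.
(* The witness is created before the primed parameters are introduced, so unification can only
   choose a value independent of them. *)
- eexists. intros rho' T0' alpha' _ _ Ha'.
  apply is_lim_transverse_amplitude; assumption.
- intros t. apply is_lim_displacement; assumption.
- intros t. apply is_lim_tension; assumption.
Qed.
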